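(* Let $u\in C^0(B_1)$ be a viscosity solution of $\Delta_\infty u=\mathcal{G}(x,u,Du)$ in $B_1\subset\mathbb{R}^n$ with $\|u\|_{L^\infty(B_1)}\le 1$, where $\mathcal{G}$ satisfies the structure condition stated in the context with weight $f$. Suppose further that $|f(x)|\le \mathrm{c}_0\,\mathrm{dist}^{\beta}(x,\mathrm{F})$ for $x\in B_1$, for some closed set $\mathrm{F}\subset B_1$, some $\beta>0$ and a universal constant $\mathrm{c}_0>0$. Let $x_0\in \mathrm{C}_{\mathcal{Z}}(u)\cap\mathrm{F}\cap B_{1/2}$. There exists $\varepsilon>0$ such that if one of the following conditions holds: (i) $\inf_{B_1}u\ge-\varepsilon$; (ii) $\dfrac{|\{u<0\}\cap B_1|}{|B_1|}\le\varepsilon$; then there is a universal constant $\mathrm{C}>0$ such that for every $r\in(0,\tfrac12)$ $$\sup_{B_r(x_0)}|u(x)|\le \mathrm{C}\,r^{\frac{4-\kappa+\beta}{3-(m+\kappa)}}.$$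
   Context: $B_r(x_0)\subset\mathbb{R}^n$ is the open ball, $B_r=B_r(0)$, $|A|$ is the Lebesgue measure of $A$. $\Delta_\infty u=\langle D^2u\,Du,Du\rangle$. Structure condition: $\mathcal{G}:B_1\times\mathbb{R}\times\mathbb{R}^n\to\mathbb{R}$ and there is a constant $C_*>0$ with $$|\mathcal{G}(x,rt,s\xi)|\le C_*\,r^m s^\kappa|f(x)||t|^m\min\{1,|\xi|^\kappa\}\quad\text{for all } r,s\in(0,1],\ x\in B_1,\ t\in\mathbb{R},\ \xi\in\mathbb{R}^n,$$ where $f\in L^\infty(B_1)\cap C^0(B_1)$ and $(m,\kappa)\in[0,3)\times[0,4)$ satisfies $m<3-\kappa$. Viscosity solution: $u$ is a viscosity subsolution (resp. supersolution) of $\Delta_\infty u=\mathcal{G}(x,u,Du)$ if whenever $\varphi\in C^2$ and $u-\varphi$ has a local maximum (resp. minimum) at $y$, then $\Delta_\infty\varphi(y)\ge\mathcal{G}(y,u(y),D\varphi(y))$ (resp. $\le$); $u$ is a viscosity solution if it is both. $\mathrm{C}_{\mathcal{Z}}(u):=\{x\in B_1: u(x)=|Du(x)|=0\}$ (in particular $u$ is differentiable at such points). A universal constant is one depending only on the data of the model ($n,m,\kappa,\beta$, $C_*$, $\mathrm{c}_0$ and $f$), not on $u$ or $r$. *)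

(* Defs.v *)
From mathcomp Require Export all_boot all_order all_algebra.
From mathcomp Require Export all_classical all_reals all_analysis.
Export Order.TTheory GRing.Theory Num.Theory.
Export numFieldNormedType.Exports.

Set Implicit Arguments.
Unset Strict Implicit.
Unset Printing Implicit Defensive.

Local Open Scope classical_set_scope.
Local Open Scope ring_scope.

Section Euclidean.
Context {R : realType} {n : nat}.
Implicit Types (x y v : 'rV[R]_n) (A F : set 'rV[R]_n).

(* The norm, and hence [ball], of the library on row vectors is the sup norm,
   so the Euclidean versions are defined here; the topology is the same. *)
Definition dotv x y : R := \sum_i x 0 i * y 0 i.

Definition enorm x : R := Num.sqrt (dotv x x).

Definition eball x (r : R) : set 'rV[R]_n := [set y | enorm (y - x) < r].

(* Only meaningful for nonempty [F]: [inf set0] is 0. *)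
Definition edist x F : R := inf [set enorm (x - y) | y in F].

Definition box (ab : 'rV[R]_n * 'rV[R]_n) : set 'rV[R]_n :=
  [set x | forall i, ab.1 0 i < x 0 i <= ab.2 0 i].

Definition box_volume (ab : 'rV[R]_n * 'rV[R]_n) : R :=
  \prod_i Num.max 0 (ab.2 0 i - ab.1 0 i).

(* n-dimensional Lebesgue outer measure, from countable covers by boxes; on
   Lebesgue measurable sets it is the Lebesgue measure. *)
Definition lebesgue_n A : \bar R :=
  ereal_inf [set (\sum_(0 <= k <oo) (box_volume (I k))%:E)%E |
    I in [set I : nat -> 'rV[R]_n * 'rV[R]_n | A `<=` \bigcup_k box (I k)]].

Definition Linfty_norm A (g : 'rV[R]_n -> R) : \bar R :=
  ereal_inf [set M : \bar R | (0 <= M)%E /\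
    lebesgue_n [set x | A x /\ (M < `|g x|%:E)%E] = 0%E].

End Euclidean.

Section Calculus.
Context {R : realType} {n : nat}.
Implicit Types (phi : 'rV[R]_n -> R) (x : 'rV[R]_n).

Definition ebase (i : 'I_n) : 'rV[R]_n := delta_mx 0 i.

Definition pderiv (i : 'I_n) phi x : R := 'D_(ebase i) phi x.

Definition gradient phi x : 'rV[R]_n := \row_i pderiv i phi x.

Definition hessian phi x : 'M[R]_n := \matrix_(i, j) pderiv i (pderiv j phi) x.

Definition C2_on (V : set 'rV[R]_n) phi : Prop := forall x, V x ->
  (forall i, derivable phi x (ebase i) /\ {for x, continuous (pderiv i phi)}) /\
  (forall i j, derivable (pderiv j phi) x (ebase i) /\
     {for x, continuous (pderiv i (pderiv j phi))}).

Definition infinity_laplacian phi x : R :=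
  dotv (hessian phi x *m (gradient phi x)^T)^T (gradient phi x).

End Calculus.

Section Viscosity.
Context {R : realType} {n : nat}.
Implicit Types (U : set 'rV[R]_n) (u : 'rV[R]_n -> R)
  (G : 'rV[R]_n -> R -> 'rV[R]_n -> R).

(* Test functions are C^2 on some open set containing the touching point; [U]
   is meant to be open, so that [\near y] only looks at points of [U]. *)
Definition viscosity_subsolution U G u : Prop :=
  forall (V : set 'rV[R]_n) (phi : 'rV[R]_n -> R) (y : 'rV[R]_n),
    U y -> open V -> V y -> C2_on V phi ->
    (\forall x \near y, u x - phi x <= u y - phi y) ->
    infinity_laplacian phi y >= G y (u y) (gradient phi y).

Definition viscosity_supersolution U G u : Prop :=
  forall (V : set 'rV[R]_n) (phi : 'rV[R]_n -> R) (y : 'rV[R]_n),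
    U y -> open V -> V y -> C2_on V phi ->
    (\forall x \near y, u x - phi x >= u y - phi y) ->
    infinity_laplacian phi y <= G y (u y) (gradient phi y).

Definition viscosity_solution U G u : Prop :=
  viscosity_subsolution U G u /\ viscosity_supersolution U G u.

(* [powR] satisfies 0 `^ 0 = 1, the convention needed when m = 0 or
   kappa = 0. *)
Definition structure_condition G (f : 'rV[R]_n -> R) (Cstar m kappa : R) : Prop :=
  forall (r s : R) (x : 'rV[R]_n) (t : R) (xi : 'rV[R]_n),
    0 < r <= 1 -> 0 < s <= 1 -> eball 0 1 x ->
    `|G x (r * t) (s *: xi)| <=
      Cstar * r `^ m * s `^ kappa * `|f x| * `|t| `^ m
        * Num.min 1 (enorm xi `^ kappa).

Definition critical_zeros u : set 'rV[R]_n :=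
  [set x | [/\ eball 0 1 x, u x = 0, differentiable u x &
               enorm (gradient u x) = 0]].

End Viscosity.

(* Main.v *)
Require Import Defs.
From mathcomp Require Import measurable_realfun ring lra.

(** The threshold [eps] may depend on the solution, so the smallness conditions
    only serve to exclude solutions that are negative somewhere: for such a
    [u], a small [eps] contradicts both conditions, because the nonempty open
    set where [u < 0] has positive Lebesgue measure ([exists_eps_of_neg]). It
    remains to bound a nonnegative [u] that vanishes at a point [x0] of [F],
    with a constant independent of [u].

    This is a Harnack-type argument by comparison with convex cones
    ([supersolution_le_of_zero]). For [y] within distance [r] of [x0], the
    barrier [A * (r - t) + B * (r - t) ^+ 2], [t] being the distance to [y],
    is positive at [x0] and zero on the sphere of radius [r] around [y]. If its
    height [A * r + B * r ^+ 2] were less than [u y], it would touch [u] from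
    below, after a vertical shift, at a regular point, where its infinity
    Laplacian is at least [2 * A ^+ 2 * B]. At that point [u] is below the
    height of the barrier, the test gradient is at most its slope, and [f] is
    at most [c0 * (2 * r) `^ beta] because [x0] is in [F]; the structure
    condition then bounds the right-hand side by a product of powers. With
    [A = T * r `^ (al - 1)] and [B = T * r `^ (al - 2)], both sides have the
    same homogeneity in [r] exactly when [al] is the exponent of the theorem,
    and since [m + kappa < 3] a large [T] makes the Laplacian win
    ([barrier_absorbs]). Hence [u y <= 2 * T * r `^ al] ([nonneg_growth]).
    This works for [r <= 1 / 4]; for larger radii the bound [`|u| <= 1] is
    enough.

    The measure-theoretic input, that nonempty open sets have positive outer
    measure, comes from Lebesgue's covering inequality for boxes
    ([le_prod_length_of_cover]). It also turns the essential bound on [u] into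
    a pointwise one ([le_Linfty_norm_of_continuous]). *)

Set Implicit Arguments.
Unset Strict Implicit.

Local Open Scope classical_set_scope.
Local Open Scope ring_scope.

(** * Volume of boxes under countable covers *)

(** Lebesgue's covering inequality for boxes, with weights [c k] on the
    covering boxes so that it can be proved by induction on the dimension:
    freezing the last coordinate at [t] leaves a weighted cover of the lower
    dimensional box by the boxes whose last side contains [t], and integrating
    the resulting inequality over [t] restores the last factor. Only the
    one-dimensional Lebesgue integral is used, and countable covers need no
    compactness argument. Vectors are sequences indexed by [nat], of which
    only the first [n] terms matter, so that the dimension can vary. *)
Lemma le_prod_length_of_cover (R : realType) (n : nat) (p q : nat -> R)
    (a b : nat -> nat -> R) (c : nat -> R) :
  (forall k, 0 <= c k) -> (forall i, p i <= q i) ->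
  (forall x : nat -> R, (forall i, (i < n)%N -> p i < x i <= q i) ->
    (1 <= \sum_(0 <= k <oo)
            (c k * \prod_(i < n) \1_(`]a k i, b k i]) (x i))%:E)%E) ->
  ((\prod_(i < n) (q i - p i))%:E <=
     \sum_(0 <= k <oo) (c k * \prod_(i < n) Num.max 0 (b k i - a k i))%:E)%E.
Proof.
elim: n c => [|n IHn] c c0 pq cover.
  rewrite big_ord0 (le_trans (cover q _))//; apply: lee_nneseries => k *.
    by rewrite big_ord0 mulr1 lee_fin.
  by rewrite !big_ord0.
set V := \prod_(i < n) (q i - p i).
pose W (k : nat) : R := \prod_(i < n) Num.max 0 (b k i - a k i).
have W0 k : 0 <= W k by apply: prodr_ge0 => i _; rewrite le_max lexx.
pose w (k : nat) : R := c k * W k.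
have w0 k : 0 <= w k by rewrite mulr_ge0.
have slice t : `]p n, q n]%classic t ->
    (V%:E <= \sum_(0 <= k <oo) ((w k)%:E * (\1_(`]a k n, b k n]) t)%:E))%E.
  rewrite /= in_itv /= => pt.
  have := IHn (fun k => c k * \1_(`]a k n, b k n]) t); rewrite -/V => IH.
  rewrite (le_trans (IH _ pq _)) => [//|k|x xpq|].
  - by rewrite mulr_ge0// indicE.
  - pose x' i := if i == n then t else x i.
    rewrite (le_trans (cover x' _))//.
      move=> i; rewrite ltnS leq_eqVlt /x'; case: eqP => [->//|_ /=].
      exact: xpq.
    apply: lee_nneseries => k *.
      by rewrite lee_fin mulr_ge0// prodr_ge0// => i _; rewrite indicE.
    rewrite big_ord_recr /= {2}/x' eqxx lee_fin mulrCA mulrC -mulrA mulrC.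
    rewrite (eq_bigr (fun i : 'I_n => \1_(`]a k i, b k i]%classic) (x i)))//.
      by rewrite mulrC mulrA.
    by move=> i _; rewrite /x' (ltn_eqF (ltn_ord i)).
  - apply: lee_nneseries => k *.
      by rewrite lee_fin mulr_ge0 ?W0 ?mulr_ge0 ?indicE.
    by rewrite -EFinM lee_fin mulrAC.
have mI k : measurable_fun `]p n, q n]%classic
    (fun t => ((w k)%:E * (\1_(`]a k n, b k n]) t)%:E)%E).
  apply: measurable_funeM; apply/measurable_EFinP.
  exact: measurable_indic.
have I0 k t : (0 <= (w k)%:E * (\1_(`]a k n, b k n]) t)%:E)%E.
  by rewrite -EFinM lee_fin mulr_ge0// indicE.
have lV : (\prod_(i < n.+1) (q i - p i))%:E =
    (\int[@lebesgue_measure R]_(t in `]p n, q n]) V%:E)%E.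
  rewrite integral_cst//= lebesgue_measure_itv /= lte_fin big_ord_recr /=.
  case: ltP => [_|qp]; first by rewrite -EFinB -EFinM.
  by rewrite (_ : q n - p n = 0) ?mulr0 ?mule0//; have := pq n; lra.
rewrite lV (@le_trans _ _ (\int[@lebesgue_measure R]_(t in `]p n, q n])
  \sum_(0 <= k <oo) ((w k)%:E * (\1_(`]a k n, b k n]) t)%:E))%E)//.
  apply: ge0_le_integral => //.
  - by move=> t _; rewrite lee_fin prodr_ge0// => i _; rewrite subr_ge0.
  - apply: (ge0_emeasurable_sum (P := xpredT)) => [k t _ _|k _].
      exact: I0.
    exact: mI.
rewrite integral_nneseries//; apply: lee_nneseries => [k _ _|k _].
  by apply: integral_ge0.
rewrite ge0_integralZl//; last 2 first.
- by apply/measurable_EFinP; exact: measurable_indic.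
- by rewrite lee_fin.
rewrite integral_indic// big_ord_recr /= mulrA -/(W k) -/(w k) [leRHS]EFinM.
rewrite lee_wpmul2l ?lee_fin//.
apply: (@le_trans _ _ (lebesgue_measure `]a k n, b k n]%classic)).
  by apply: le_measure; rewrite ?inE//; exact: measurableI.
rewrite lebesgue_measure_itv /= lte_fin; case: ltP => ab.
  by rewrite -EFinB lee_fin le_max lexx orbT.
by rewrite lee_fin le_max lexx.
Qed.

(** * Euclidean geometry of row vectors *)

Section Euclid.
Context {R : realType} {n : nat}.
Implicit Types (x y z v : 'rV[R]_n).

Lemma dotvC x y : dotv x y = dotv y x.
Proof. by apply: eq_bigr => i _; rewrite mulrC. Qed.

Lemma dotvDl x y z : dotv (x + y) z = dotv x z + dotv y z.
Proof. by rewrite -big_split; apply: eq_bigr => i _; rewrite mxE mulrDl. Qed.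

Lemma dotvZl (k : R) x y : dotv (k *: x) y = k * dotv x y.
Proof. by rewrite mulr_sumr; apply: eq_bigr => i _; rewrite mxE mulrA. Qed.

Lemma dotvDr x y z : dotv x (y + z) = dotv x y + dotv x z.
Proof. by rewrite dotvC dotvDl !(dotvC x). Qed.

Lemma dotvZr (k : R) x y : dotv x (k *: y) = k * dotv x y.
Proof. by rewrite dotvC dotvZl dotvC. Qed.

Lemma dotv_ge0 x : 0 <= dotv x x.
Proof. by apply: sumr_ge0 => i _; rewrite -expr2 sqr_ge0. Qed.

Lemma dotv_ebase (i : 'I_n) x : dotv (ebase i) x = x 0 i.
Proof.
rewrite /dotv (bigD1 i)//= big1 => [|j ji]; last first.
  by rewrite mxE (negbTE ji) andbF mul0r.
by rewrite mxE !eqxx mul1r addr0.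
Qed.

Lemma enorm_ge0 x : 0 <= enorm x.
Proof. exact: sqrtr_ge0. Qed.

Lemma sqr_enorm x : enorm x ^+ 2 = dotv x x.
Proof. by rewrite sqr_sqrtr// dotv_ge0. Qed.

Lemma enormN x : enorm (- x) = enorm x.
Proof. by congr Num.sqrt; rewrite -scaleN1r dotvZl dotvZr mulrA mulrNN !mul1r. Qed.

Lemma enormZ (k : R) x : enorm (k *: x) = `|k| * enorm x.
Proof.
by rewrite /enorm dotvZl dotvZr mulrA -expr2 sqrtrM ?sqr_ge0// sqrtr_sqr.
Qed.

Lemma enorm_distC x y : enorm (x - y) = enorm (y - x).
Proof. by rewrite -enormN opprB. Qed.

Lemma ler_norm_enorm x (i : 'I_n) : `|x 0 i| <= enorm x.
Proof.
rewrite -sqrtr_sqr ler_wsqrtr// /dotv (bigD1 i)//= -expr2 lerDl.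
by apply: sumr_ge0 => j _; rewrite -expr2 sqr_ge0.
Qed.

Lemma ler_norm_mx_enorm x : `|x| <= enorm x.
Proof.
rewrite [`|x|]mx_normrE; apply/bigmax_leP; split=> [|[i j] _].
  exact: enorm_ge0.
by rewrite (ord1 i); exact: ler_norm_enorm.
Qed.

Lemma enorm_eq0 x : enorm x = 0 -> x = 0.
Proof.
move=> x0; apply/rowP => i; apply/eqP; rewrite mxE -normr_le0 -x0.
exact: ler_norm_enorm.
Qed.

(** Cauchy-Schwarz, from the nonnegativity of the square of the vector
    [enorm y *: x - enorm x *: y]. *)
Lemma dotv_le_enorm x y : dotv x y <= enorm x * enorm y.
Proof.
have [/enorm_eq0->|x0] := eqVneq (enorm x) 0.
  by rewrite -(scale0r 0) dotvZl enormZ normr0 !mul0r.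
have [/enorm_eq0->|y0] := eqVneq (enorm y) 0.
  by rewrite -(scale0r 0) dotvZr enormZ normr0 !mul0r mulr0.
have xp : 0 < enorm x by rewrite lt_def x0 enorm_ge0.
have yp : 0 < enorm y by rewrite lt_def y0 enorm_ge0.
have := dotv_ge0 (enorm y *: x + (- enorm x) *: y).
rewrite !(dotvDl, dotvDr, dotvZl, dotvZr) -!sqr_enorm (dotvC y x) => h.
rewrite -subr_ge0 -(pmulr_rge0 _ (mulr_gt0 xp yp)) -(pmulr_rge0 _ (ltr0Sn R 1)).
by apply: le_trans h _; rewrite le_eqVlt; apply/orP; left; apply/eqP; ring.
Qed.

Lemma ler_enormD x y : enorm (x + y) <= enorm x + enorm y.
Proof.
rewrite -(ler_pXn2r (ltn0Sn 1)) ?nnegrE ?addr_ge0 ?enorm_ge0//.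
rewrite sqr_enorm !(dotvDl, dotvDr) (dotvC y x) sqrrD -!sqr_enorm.
by have := dotv_le_enorm x y; lra.
Qed.

Lemma ler_enorm_distD z x y : enorm (x - y) <= enorm (x - z) + enorm (z - y).
Proof. by apply: le_trans (ler_enormD _ _); rewrite addrA subrK. Qed.

Lemma continuous_coord_sub (y : 'rV[R]_n) (i : 'I_n) :
  continuous (fun x : 'rV[R]_n => (x - y) 0 i).
Proof.
rewrite (_ : (fun _ => _) = (fun x : 'rV[R]_n => x 0 i - y 0 i)).
  by move=> x; apply: continuousB; [exact: coord_continuous|exact: cst_continuous].
by apply/funext => x; rewrite !mxE.
Qed.

Lemma continuous_sqdist (y : 'rV[R]_n) :
  continuous (fun x : 'rV[R]_n => dotv (x - y) (x - y)).
Proof.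
rewrite /dotv; elim: (index_enum _) => [|i s IHs] x.
  rewrite (_ : (fun _ => _) = cst 0); first exact: cst_continuous.
  by apply/funext => z; rewrite big_nil.
rewrite (_ : (fun _ => _) = (fun z => (z - y) 0 i * (z - y) 0 i) +
    (fun z => \sum_(j <- s) (z - y) 0 j * (z - y) 0 j)); last first.
  by apply/funext => z; rewrite big_cons.
apply: continuousD; last exact: IHs.
by apply: continuousM; exact: continuous_coord_sub.
Qed.

Lemma continuous_enorm_sub (y : 'rV[R]_n) :
  continuous (fun x : 'rV[R]_n => enorm (x - y)).
Proof.
move=> x.
apply: (@continuous_comp _ _ _ (fun x => dotv (x - y) (x - y)) Num.sqrt).
  exact: continuous_sqdist.
exact: sqrt_continuous.
Qed.

Lemma open_eball (x : 'rV[R]_n) (r : R) : open (eball x r).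
Proof.
rewrite (_ : eball x r = (fun y => enorm (y - x)) @^-1` [set t | t < r])//.
by apply: open_comp => [? _|]; [exact: continuous_enorm_sub|exact: open_lt].
Qed.

(** The euclidean norm dominates the sup norm, for which bounded closed sets
    are known to be compact. *)
Lemma compact_closed_eball (x : 'rV[R]_n) (r : R) :
  compact [set y : 'rV[R]_n | enorm (y - x) <= r].
Proof.
apply: bounded_closed_compact.
  exists (`|x| + r); split; first exact: num_real.
  move=> M hM y /= yr.
  rewrite -[y](subrK x) addrC (le_trans (ler_normD _ _))// ltW//.
  by rewrite (le_lt_trans _ hM)// lerD2l (le_trans (ler_norm_mx_enorm _)).
rewrite (_ : [set _ | _] = (fun y => enorm (y - x)) @^-1` [set t | t <= r])//.
by apply: preimage_closed => [? _|]; [exact: continuous_enorm_sub|exact: closed_le].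
Qed.

End Euclid.

(** * Lebesgue outer measure of open sets *)

Section LebesgueOuter.
Context {R : realType} {n : nat}.
Implicit Types (A B : set 'rV[R]_n) (a b x : 'rV[R]_n).

Lemma box_volume_ge0 (ab : 'rV[R]_n * 'rV[R]_n) : 0 <= box_volume ab.
Proof. by apply: prodr_ge0 => i _; rewrite le_max lexx. Qed.

Lemma le_lebesgue_n A B : A `<=` B -> (lebesgue_n A <= lebesgue_n B)%E.
Proof.
move=> AB; apply: ereal_inf_le_tmp => _ [I BI <-].
by exists I => //; exact: subset_trans BI.
Qed.

Lemma lebesgue_n_box_le a b : (0 < n)%N ->
  (lebesgue_n (box (a, b)) <= (box_volume (a, b))%:E)%E.
Proof.
move=> n0; apply: ge_ereal_inf.
(* The box itself, followed by boxes of volume 0; these exist since n > 0. *)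
exists (\sum_(0 <= k <oo) (box_volume (if k == 0%N then (a, b) else (0, 0)))%:E)%E.
  exists (fun k => if k == 0%N then (a, b) else (0, 0)) => //.
  by move=> x abx; exists 0%N.
rewrite nneseries_recl//; last by move=> k _; rewrite lee_fin box_volume_ge0.
rewrite /= eseries0 ?adde0// => k k1 _; rewrite (gtn_eqF k1).
rewrite /box_volume (bigD1 (Ordinal n0))//= mxE subrr maxxx mul0r//.
Qed.

(** A row vector padded with zeros, the shape in which
    [le_prod_length_of_cover] takes its boxes. *)
Let ext (v : 'rV[R]_n) (i : nat) : R := oapp (v 0) 0 (insub i).

Let extE v (i : 'I_n) : ext v i = v 0 i.
Proof. by rewrite /ext valK. Qed.

Lemma box_volume_le_lebesgue_n a b : (forall i, a 0 i <= b 0 i) ->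
  ((box_volume (a, b))%:E <= lebesgue_n (box (a, b)))%E.
Proof.
move=> ab; apply: le_ereal_inf_tmp => _ [I abI <-].
have := @le_prod_length_of_cover R n (ext a) (ext b)
  (fun k => ext (I k).1) (fun k => ext (I k).2) (fun=> 1).
have -> : \prod_(i < n) (ext b i - ext a i) = box_volume (a, b).
  by apply: eq_bigr => i _; rewrite !extE max_r// subr_ge0.
under [X in _ -> _ -> _ -> (_ <= X)%E]eq_eseriesr => k _.
  rewrite mul1r; under eq_bigr do rewrite !extE. over.
apply => [//|i|x xab]; first by rewrite /ext; case: insubP => //=.
have /abI[k _ xk] : box (a, b) (\row_i x i).
  by move=> i; rewrite mxE -!extE xab.
have t0 j : (0 <= (1 * \prod_(i < n)
    \1_(`]ext (I j).1 i, ext (I j).2 i]%classic) (x i))%:E)%E.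
  by rewrite mul1r lee_fin prodr_ge0// => i _; rewrite indicE.
rewrite (nneseriesD1 (n := k))// big1 ?mul1r.
  by rewrite leeDl// nneseries_ge0.
move=> i _; rewrite indicE mem_set//= in_itv /= !extE.
by have := xk i; rewrite mxE.
Qed.

Lemma lebesgue_n_open_gt0 A : open A -> A !=set0 -> (0 < lebesgue_n A)%E.
Proof.
move=> oA [x Ax]; have /nbhs_ballP[e /= e0 eA] : nbhs x A by exact: open_nbhs_nbhs.
pose a := \row_i (x 0 i - e / 2); pose b := \row_i (x 0 i + e / 2).
have boxA : box (a, b) `<=` A.
  move=> y yab; apply: eA; split=> // i j; rewrite ord1.
  have := yab j; rewrite /= !mxE => /andP[h1 h2].
  by rewrite /ball /= ltr_norml; apply/andP; split; lra.
rewrite (lt_le_trans _ (le_lebesgue_n boxA))//.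
rewrite (lt_le_trans _ (box_volume_le_lebesgue_n _))// => [|i].
  rewrite lte_fin; apply: prodr_gt0 => i _; rewrite lt_max !mxE.
  by apply/orP; right; lra.
by rewrite !mxE; lra.
Qed.

Lemma lebesgue_n_eball_lty x (r : R) : (0 < n)%N ->
  (lebesgue_n (eball x r) < +oo)%E.
Proof.
move=> n0; pose a := \row_i (x 0 i - r); pose b := \row_i (x 0 i + r).
apply: (@le_lt_trans _ _ (lebesgue_n (box (a, b)))).
  apply: le_lebesgue_n => y /= yx i; have := ler_norm_enorm (y - x) i.
  rewrite !mxE => /le_lt_trans/(_ yx); rewrite ltr_norml => /andP[h1 h2].
  by apply/andP; split; lra.
by rewrite (le_lt_trans (lebesgue_n_box_le _ _ n0))// ltry.
Qed.

(** For a continuous function, a value above the essential bound would be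
    exceeded on a nonempty open set, which is not null. *)
Lemma le_Linfty_norm_of_continuous A (g : 'rV[R]_n -> R) (M : R) :
  open A -> {in A, continuous g} -> (Linfty_norm A g <= M%:E)%E ->
  forall x, A x -> `|g x| <= M.
Proof.
move=> oA cg gM x Ax; rewrite leNgt; apply/negP => Mx.
have /ereal_inf_lt[N [N0 N0']] : (Linfty_norm A g < (`|g x|)%:E)%E.
  by rewrite (le_lt_trans gM)// lte_fin.
case: N N0 N0' => [N| |]; rewrite ?leeNy_eq// => N0 NA Nx.
have : (0 < lebesgue_n (A `&` g @^-1` [set t | (N < `|t|)%R]))%E.
  apply: lebesgue_n_open_gt0; last by exists x.
  apply: (proj1 (continuous_inP _ oA) cg).
  rewrite (_ : [set _ | _] = Num.norm @^-1` [set t : R | N < t])//.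
  by apply: open_comp => [? _|]; [exact: norm_continuous|exact: open_gt].
by rewrite -NA ltxx.
Qed.

End LebesgueOuter.

(** * Derivatives of radial functions *)

Section DirectionalDerivative.
Context {R : realType} {n : nat}.
Implicit Types (x y v : 'rV[R]_n) (phi : 'rV[R]_n -> R).

(** Reduces a directional derivative to a derivative of a function of one
    real variable, where the chain rule applies. *)
Lemma is_derive_line phi x v (l : R) :
  is_derive (0 : R) 1 (fun t : R => phi (t *: v + x)) l -> is_derive x v phi l.
Proof.
move=> [dphi <-]; apply: DeriveDef; first exact/derivable1P.
rewrite /derive; set g1 := fun h => h^-1 *: _; set g2 := fun h => h^-1 *: _.
suff -> : g1 = g2 by [].
apply/funext => t; rewrite /g1 /g2 /=.
by rewrite addr0 scale0r add0r [_%:A]mulr1.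
Qed.

Lemma is_derive_quadratic (a b c : R) :
  is_derive (0 : R) 1 (fun t => a * t ^+ 2 + b * t + c) b.
Proof.
rewrite (_ : (fun _ => _) = a \*: (@id R) ^+ 2 + b \*: (@id R) + cst c).
  apply: is_derive_eq.
  by rewrite mulr0 scale0r scaler0 add0r addr0 [b *: _]mulr1.
by apply/funext => t.
Qed.

End DirectionalDerivative.

(** Radial functions are written as functions of the squared distance [q] to
    [y], a polynomial in the coordinates; thus the only singular point is the
    one of [h] at 0. *)
Section Radial.
Context {R : realType} {n : nat} (y : 'rV[R]_n) (h h1 h2 : R -> R).
Hypothesis dh : forall s : R, 0 < s -> is_derive s 1 h (h1 s).
Hypothesis dh1 : forall s : R, 0 < s -> is_derive s 1 h1 (h2 s).
Hypothesis ch2 : forall s : R, 0 < s -> {for s, continuous h2}.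

Let q (x : 'rV[R]_n) : R := dotv (x - y) (x - y).
Let phi x := h (q x).

Lemma open_sqdist_gt0 : open [set x | 0 < q x].
Proof.
rewrite (_ : [set _ | _] = q @^-1` [set s | 0 < s])//.
by apply: open_comp => [? _|]; [exact: continuous_sqdist|exact: open_gt].
Qed.

Lemma is_derive_comp_sqdist (g : R -> R) (l : R) x v :
  is_derive (q x) 1 g l ->
  is_derive x v (fun z => g (q z)) (l * (2 * dotv v (x - y))).
Proof.
move=> dg; apply: is_derive_line.
apply: (@is_derive1_comp _ g (fun t => q (t *: v + x))).
  by rewrite scale0r add0r.
rewrite (_ : (fun _ => _) = (fun t => dotv v v * t ^+ 2
    + (2 * dotv v (x - y)) * t + dotv (x - y) (x - y))).
  exact: is_derive_quadratic.
apply/funext => t; rewrite /q -addrA; move: (x - y) => w.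
by rewrite !(dotvDl, dotvDr, dotvZl, dotvZr) (dotvC w v); ring.
Qed.

Let D1 (i : 'I_n) x := h1 (q x) * (2 * (x - y) 0 i).
Let D2 (i j : 'I_n) x :=
  h2 (q x) * (2 * (x - y) 0 i) * (2 * (x - y) 0 j) + h1 (q x) * (2 * (i == j)%:R).

Let is_derive_phi x i : 0 < q x -> is_derive x (ebase i) phi (D1 i x).
Proof.
by move=> qx; rewrite /D1 -dotv_ebase; apply: is_derive_comp_sqdist; exact: dh.
Qed.

Let is_derive_D1 x i j : 0 < q x -> is_derive x (ebase i) (D1 j) (D2 i j x).
Proof.
move=> qx; have dc : is_derive x (ebase i) (fun z => 2 * (z - y) 0 j)
    (2 * (i == j)%:R : R).
  apply: is_derive_line.
  rewrite (_ : (fun _ => _) = (fun t => 0 * t ^+ 2 + (2 * (i == j)%:R) * t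
      + 2 * (x - y) 0 j)); first exact: is_derive_quadratic.
  by apply/funext => t; rewrite !mxE eqxx /= (eq_sym j i); ring.
have dm := is_deriveM (is_derive_comp_sqdist (ebase i) (dh1 qx)) dc.
apply: (is_derive_eq dm); rewrite /D2 dotv_ebase.
by rewrite /GRing.scale /= addrC; ring.
Qed.

Let near_q x : 0 < q x -> \forall z \near x, 0 < q z.
Proof. by move=> qx; apply: open_nbhs_nbhs; split=> //; exact: open_sqdist_gt0. Qed.

Let pderivE x i : 0 < q x -> pderiv i phi x = D1 i x.
Proof. by move=> qx; apply: derive_val; exact: is_derive_phi. Qed.

Let near_pderiv x i : 0 < q x -> \forall z \near x, D1 i z = pderiv i phi z.
Proof.
move=> qx; apply: filterS (near_q qx) => z qz; exact/esym/pderivE.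
Qed.

Let is_derive_pderiv x i j : 0 < q x ->
  is_derive x (ebase i) (pderiv j phi) (D2 i j x).
Proof.
by move=> qx; apply: near_eq_is_derive (near_pderiv j qx) _; exact: is_derive_D1.
Qed.

Let near_pderiv2 x i j : 0 < q x ->
  \forall z \near x, D2 i j z = pderiv i (pderiv j phi) z.
Proof.
move=> qx; apply: filterS (near_q qx) => z qz.
by apply/esym/derive_val; exact: is_derive_pderiv.
Qed.

Let continuous_near (f g : 'rV[R]_n -> R) x :
  (\forall z \near x, f z = g z) -> {for x, continuous f} -> {for x, continuous g}.
Proof.
move=> fg cf; rewrite /prop_for /continuous_at -(nbhs_singleton fg).
exact: cvg_trans (near_eq_cvg fg) cf.
Qed.

Let continuous_2coord x (i : 'I_n) :
  {for x, continuous (fun z : 'rV[R]_n => 2 * (z - y) 0 i)}.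
Proof.
by apply: continuousM; [exact: cst_continuous|exact: continuous_coord_sub].
Qed.

Let continuous_comp_q (g : R -> R) x :
  {for q x, continuous g} -> {for x, continuous (fun z => g (q z))}.
Proof. by move=> cg; apply: continuous_comp => //; exact: continuous_sqdist. Qed.

Lemma C2_on_radial : C2_on [set x | 0 < q x] phi.
Proof.
move=> x qx; split=> [i|i j].
  split; first by case: (is_derive_phi i qx).
  apply: continuous_near (near_pderiv i qx) _.
  apply: continuousM; last exact: continuous_2coord.
  apply: continuous_comp_q.
  by apply/differentiable_continuous/derivable1_diffP; case: (dh1 qx).
split; first by case: (is_derive_pderiv i j qx).
apply: continuous_near (near_pderiv2 i j qx) _.
apply: continuousD.
  apply: continuousM; last exact: continuous_2coord.
  apply: continuousM; last exact: continuous_2coord.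
  by apply: continuous_comp_q; exact: ch2.
apply: continuousM; last exact: cst_continuous.
apply: continuous_comp_q.
by apply/differentiable_continuous/derivable1_diffP; case: (dh1 qx).
Qed.

Lemma gradient_radial x : 0 < q x -> gradient phi x = (2 * h1 (q x)) *: (x - y).
Proof.
move=> qx; apply/rowP => i; rewrite [LHS]mxE pderivE// [RHS]mxE /D1; ring.
Qed.

Let hessianE x i j : 0 < q x -> hessian phi x i j = D2 i j x.
Proof.
by move=> qx; rewrite mxE; apply: derive_val; exact: is_derive_pderiv.
Qed.

(** With [w = x - y], the gradient is [2 h1 w] and the hessian is
    [4 h2 w w^T + 2 h1 I], so [w] is an eigenvector of the hessian. *)
Lemma infinity_laplacian_radial x : 0 < q x ->
  infinity_laplacian phi x =
    8 * h1 (q x) ^+ 2 * q x * (2 * q x * h2 (q x) + h1 (q x)).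
Proof.
move=> qx; rewrite /infinity_laplacian gradient_radial//.
have -> : (hessian phi x *m ((2 * h1 (q x)) *: (x - y))^T)^T =
    (4 * h1 (q x) * (2 * q x * h2 (q x) + h1 (q x))) *: (x - y).
  apply/rowP => i; rewrite mxE [RHS]mxE [LHS]mxE.
  set w := x - y; set a1 := h1 (q x); set a2 := h2 (q x).
  transitivity (\sum_j (8 * a1 * a2 * w 0 i * (w 0 j * w 0 j)
      + 4 * a1 ^+ 2 * (ebase i 0 j * w 0 j))).
    apply: eq_bigr => j _; rewrite hessianE// [w]lock !mxE -lock.
    by rewrite /D2 -/w -/a1 -/a2 eqxx /= (eq_sym j i); ring.
  rewrite big_split /= -!mulr_sumr -/(dotv w w) -/(dotv (ebase i) w) dotv_ebase.
  by rewrite -/(q x); ring.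
by rewrite dotvZl dotvZr -/(q x); ring.
Qed.

End Radial.

(** * Comparison with cones *)

Section Cone.
Context {R : realType} {n : nat}.
Implicit Types (b c s : R) (x y z : 'rV[R]_n).

Let is_derive_cone b c s : 0 < s ->
  is_derive s 1 (fun s => c * s - b * Num.sqrt s) (c - b / (2 * Num.sqrt s)).
Proof.
move=> s0; have ds := is_derive1_sqrt s0.
rewrite (_ : (fun _ => _) = c \*: (@id R) - b \*: Num.sqrt) //.
apply: is_derive_eq.
by rewrite /GRing.scale /= !mulr1 mulN1r.
Qed.

Let is_derive_cone1 b c s : 0 < s ->
  is_derive s 1 (fun s => c - b / (2 * Num.sqrt s)) (b / (4 * Num.sqrt s ^+ 3)).
Proof.
move=> s0; have ds := is_derive1_sqrt s0.
have r0 : Num.sqrt s != 0 by rewrite gt_eqF// sqrtr_gt0.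
have dV := @is_deriveV _ _ _ _ _ r0 ds.
rewrite (_ : (fun _ => _) = cst c - (b / 2) \*: (fun s => (Num.sqrt s)^-1)).
  apply: is_derive_eq.
  rewrite sub0r /GRing.scale /=; field.
  by [].
by apply/funext => t; rewrite /= /GRing.scale /= invfM mulrA.
Qed.

Let continuous_cone2 b s : 0 < s ->
  {for s, continuous (fun s => b / (4 * Num.sqrt s ^+ 3))}.
Proof.
move=> s0; apply: continuousM; first exact: cst_continuous.
have r0 : 0 < Num.sqrt s by rewrite sqrtr_gt0.
apply: continuousV; first by rewrite mulf_neq0 ?expf_neq0 ?gt_eqF.
apply: continuousM; first exact: cst_continuous.
apply: (@continuous_comp _ _ _ Num.sqrt (fun t => t ^+ 3)).
  exact: sqrt_continuous.
exact: exprn_continuous.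
Qed.

(** Up to the additive constant [A * r + B * r ^+ 2], this is
    [A * (r - t) + B * (r - t) ^+ 2] with [t = enorm (x - y)], when
    [b = A + 2 * B * r] and [c = B]. *)
Definition cone y b c x : R := c * dotv (x - y) (x - y) - b * enorm (x - y).

Lemma C2_on_cone y b c : C2_on [set x | 0 < dotv (x - y) (x - y)] (cone y b c).
Proof.
exact: (C2_on_radial (@is_derive_cone b c) (@is_derive_cone1 b c)
  (@continuous_cone2 b)).
Qed.

Lemma enorm_gradient_cone y b c x : 0 < enorm (x - y) ->
  enorm (gradient (cone y b c) x) = `|2 * c * enorm (x - y) - b|.
Proof.
move=> t0.
have q0 : 0 < dotv (x - y) (x - y) by rewrite -sqr_enorm exprn_gt0.
rewrite (gradient_radial (@is_derive_cone b c) q0) enormZ -/(enorm _).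
rewrite -{2}(ger0_norm (ltW t0)) -normrM; congr `|_|.
by field; rewrite gt_eqF.
Qed.

Lemma infinity_laplacian_cone y b c x : 0 < enorm (x - y) ->
  infinity_laplacian (cone y b c) x =
    2 * c * (2 * c * enorm (x - y) - b) ^+ 2.
Proof.
move=> t0.
have q0 : 0 < dotv (x - y) (x - y) by rewrite -sqr_enorm exprn_gt0.
rewrite (infinity_laplacian_radial (@is_derive_cone b c) (@is_derive_cone1 b c) q0).
rewrite -/(enorm (x - y)) -sqr_enorm.
by field; rewrite gt_eqF.
Qed.

(** Comparison with a convex cone from below. If [u y] exceeded the height
    of the barrier [A * (r - t) + B * (r - t) ^+ 2], [t] the distance to [y],
    then [u] minus the barrier would be positive at [y], nonnegative on the
    sphere of radius [r] and negative at [x0], hence minimal at an interior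
    point other than the singular point [y]. There the barrier is a test
    function whose infinity Laplacian is at least [2 * A ^+ 2 * B]. The
    contact point moreover lies where [u] is below the height of the barrier
    and the test gradient has norm at most [A + 2 * B * r], so the right-hand
    side needs to be small only there: no bound on [u] or on its gradient has
    to be known in advance. *)
Lemma supersolution_le_of_zero (U : set 'rV[R]_n) G (u : 'rV[R]_n -> R)
    y x0 (r A B : R) :
  open U -> {in U, continuous u} -> (forall x, U x -> 0 <= u x) ->
  viscosity_supersolution U G u ->
  (forall x, enorm (x - y) <= r -> U x) ->
  enorm (x0 - y) < r -> u x0 = 0 -> 0 < A -> 0 < B ->
  (forall z xi, enorm (z - y) < r -> u z <= A * r + B * r ^+ 2 ->
     enorm xi <= A + 2 * B * r -> G z (u z) xi < 2 * A ^+ 2 * B) ->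
  u y <= A * r + B * r ^+ 2.
Proof.
move=> oU cu u0 super KU x0r ux0 A0 B0 hG; rewrite leNgt; apply/negP => uy.
set b := A + 2 * B * r in hG.
pose K := [set x | enorm (x - y) <= r].
have ccone : continuous (cone y b B).
  move=> x; apply: (@continuousB _ _ _ (fun x => B * dotv (x - y) (x - y))
    (fun x => b * enorm (x - y))).
    by apply: continuousM; [exact: cst_continuous|exact: continuous_sqdist].
  by apply: continuousM; [exact: cst_continuous|exact: continuous_enorm_sub].
(* The constant of the barrier is dropped: it does not affect minimality. *)
have [|||z zK zmin] := @EVT_min_rV R n (fun x => u x - cone y b B x) K.
- by exists x0; exact: ltW.
- exact: compact_closed_eball.
- apply: continuous_in_subspaceT => x xK; apply: continuousB; last exact: ccone.
  by apply: cu; apply/mem_set/KU; move/set_mem: xK.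
have {zK}zr : enorm (z - y) <= r by move/set_mem : zK.
have r0 : 0 < r by rewrite (le_lt_trans (enorm_ge0 _) x0r).
have coneE x : cone y b B x = A * (r - enorm (x - y)) + B * (r - enorm (x - y)) ^+ 2
    - (A * r + B * r ^+ 2).
  by rewrite /cone -sqr_enorm /b; ring.
have uz : u z < A * (r - enorm (z - y)) + B * (r - enorm (z - y)) ^+ 2.
  have := zmin x0 (mem_set (ltW x0r)); rewrite ux0 !coneE.
  have : 0 < A * (r - enorm (x0 - y)) by rewrite mulr_gt0// subr_gt0.
  have : 0 <= B * (r - enorm (x0 - y)) ^+ 2 by rewrite mulr_ge0 ?sqr_ge0// ltW.
  lra.
have {}zr : enorm (z - y) < r.
  rewrite lt_neqAle zr andbT; apply/eqP => zr'.
  move: uz; rewrite zr' subrr mulr0 expr0n /= mulr0 addr0 ltNge u0//.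
  by apply: KU; rewrite zr'.
have z0 : 0 < enorm (z - y).
  rewrite lt_neqAle enorm_ge0 andbT; apply/eqP => /esym zy0.
  have zy : z = y by apply/eqP; rewrite -subr_eq0; apply/eqP/enorm_eq0.
  by move: uz uy; rewrite zy0 zy subr0; lra.
have Uz : U z by apply: KU; exact: ltW.
have near_z : \forall x \near z, u x - cone y b B x >= u z - cone y b B z.
  apply: filterS (_ : \forall x \near z, eball y r x).
    by move=> x xr; apply: zmin; apply/mem_set/ltW.
  by apply: open_nbhs_nbhs; split => //; exact: open_eball.
have := super _ _ _ Uz (@open_sqdist_gt0 R n y) _ (@C2_on_cone y b B) near_z.
rewrite /= -sqr_enorm exprn_gt0// => /(_ isT).
rewrite infinity_laplacian_cone// leNgt => /negP; apply.
have bE : 2 * B * enorm (z - y) - b = - (A + 2 * B * (r - enorm (z - y))).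
  by rewrite /b; ring.
have Brz : 0 < B * (r - enorm (z - y)) by rewrite mulr_gt0// subr_gt0.
have Bz : 0 < B * enorm (z - y) by rewrite mulr_gt0.
apply: lt_le_trans (_ : 2 * A ^+ 2 * B <= _).
  apply: hG => //.
    apply/ltW/(lt_le_trans uz); rewrite lerD//.
      by rewrite ler_pM2l// gerBl ltW.
    by rewrite ler_pM2l// lerXn2r ?nnegrE// ?subr_ge0 ?gerBl ltW.
  rewrite enorm_gradient_cone// bE normrN ger0_norm; last by lra.
  by rewrite /b; lra.
rewrite bE sqrrN mulrAC ler_pM2l ?mulr_gt0// lerXn2r ?nnegrE//; lra.
Qed.

End Cone.

(** * Growth of nonnegative supersolutions near a zero *)

Section Growth.
Context {R : realType}.

(** The exponent [al] is the one for which both sides scale like the same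
    power of [r]; the inequality is then one between powers of [T], true for
    large [T] because [m + kappa < 3]. The left-hand side is what the
    structure condition yields, with [K = Cstar * c0], at a point within
    distance [2 * r] of [F] where [u] is at most the height
    [2 * T * r `^ al] of the barrier with [A = T * r `^ (al - 1)] and
    [B = T * r `^ (al - 2)], and the gradient at most its maximal slope
    [3 * T * r `^ (al - 1)]. *)
Lemma barrier_absorbs (m kappa beta K : R) : 0 < K -> m + kappa < 3 ->
  let al := (4 - kappa + beta) / (3 - (m + kappa)) in
  exists2 T : R, 0 < T & forall r : R, 0 < r ->
    K * (2 * r) `^ beta * (2 * T * r `^ al) `^ m * (3 * T * r `^ (al - 1)) `^ kappa
      < 2 * (T * r `^ (al - 1)) ^+ 2 * (T * r `^ (al - 2)).
Proof.
move=> K0 mk al; set d := 3 - (m + kappa).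
have d0 : 0 < d by rewrite subr_gt0.
pose K1 := K * 2 `^ beta * 2 `^ m * 3 `^ kappa.
have K10 : 0 < K1 by rewrite !mulr_gt0// powR_gt0.
(* Chosen so that T ^ (3 - (m + kappa)) exceeds K1 by 1. *)
pose T := (K1 + 1) `^ d^-1.
have T0 : 0 < T by rewrite powR_gt0// ltr_wpDl// ltW.
exists T => // r r0.
have p0 s : 0 < r `^ s by rewrite powR_gt0.
have pT0 s : 0 < T `^ s by rewrite powR_gt0.
have rD s t : r `^ (s + t) = r `^ s * r `^ t.
  by rewrite powRD// (gt_eqF r0) implybT.
have TD s t : T `^ (s + t) = T `^ s * T `^ t.
  by rewrite powRD// (gt_eqF T0) implybT.
have Td : T `^ d = K1 + 1.
  by rewrite /T -powRrM mulVf ?gt_eqF// powRr1// addr_ge0// ltW.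
clearbody T.
have T3 : T ^+ 3 = T `^ m * T `^ kappa * (K1 + 1).
  by rewrite -powR_mulrn ?ltW// -Td -!TD; congr (_ `^ _); rewrite /d; ring.
have r3 : (r `^ (al - 1)) ^+ 2 * r `^ (al - 2) =
    r `^ beta * r `^ (al * m) * r `^ ((al - 1) * kappa).
  rewrite expr2 -!rD; congr (_ `^ _).
  have : al * d = 4 - kappa + beta by rewrite /al divfK ?gt_eqF.
  by rewrite /d; lra.
have -> : 2 * (T * r `^ (al - 1)) ^+ 2 * (T * r `^ (al - 2)) =
    2 * T ^+ 3 * ((r `^ (al - 1)) ^+ 2 * r `^ (al - 2)) by ring.
rewrite r3 T3 !powRM ?mulr_ge0 ?ltW// -!powRrM.
have -> : K * (2 `^ beta * r `^ beta) * (2 `^ m * T `^ m * r `^ (al * m)) *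
    (3 `^ kappa * T `^ kappa * r `^ ((al - 1) * kappa)) =
    K1 * (T `^ m * T `^ kappa *
      (r `^ beta * r `^ (al * m) * r `^ ((al - 1) * kappa))) by rewrite /K1; ring.
have -> : 2 * (T `^ m * T `^ kappa * (K1 + 1)) *
    (r `^ beta * r `^ (al * m) * r `^ ((al - 1) * kappa)) =
    2 * (K1 + 1) * (T `^ m * T `^ kappa *
      (r `^ beta * r `^ (al * m) * r `^ ((al - 1) * kappa))) by ring.
by rewrite ltr_pM2r ?mulr_gt0//; lra.
Qed.

Lemma edist_le n (F : set 'rV[R]_n) x y : F y -> edist x F <= enorm (x - y).
Proof.
move=> Fy; apply: ge_inf; last by exists y.
by exists 0 => _ [z _ <-]; exact: enorm_ge0.
Qed.

Lemma edist_ge0 n (F : set 'rV[R]_n) x y : F y -> 0 <= edist x F.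
Proof.
move=> Fy; apply: lb_le_inf; first by exists (enorm (x - y)); exists y.
by move=> _ [z _ <-]; exact: enorm_ge0.
Qed.

Lemma nonneg_growth n (m kappa beta Cstar c0 T : R) :
  0 <= m -> 0 <= kappa -> 0 <= beta -> 0 < Cstar -> 0 <= c0 -> 0 < T ->
  let al := (4 - kappa + beta) / (3 - (m + kappa)) in
  (forall r : R, 0 < r ->
    Cstar * c0 * (2 * r) `^ beta * (2 * T * r `^ al) `^ m
        * (3 * T * r `^ (al - 1)) `^ kappa
      < 2 * (T * r `^ (al - 1)) ^+ 2 * (T * r `^ (al - 2))) ->
  forall f G (F : set 'rV[R]_n) (u : 'rV[R]_n -> R) x0,
    structure_condition G f Cstar m kappa ->
    (forall x, eball 0 1 x -> `|f x| <= c0 * edist x F `^ beta) ->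
    {in eball 0 1, continuous u} ->
    viscosity_supersolution (eball 0 1) G u ->
    (forall x, eball 0 1 x -> 0 <= u x) ->
    u x0 = 0 -> F x0 -> enorm x0 < 1 / 2 ->
    forall r y, 0 < r <= 1 / 4 -> enorm (y - x0) < r -> u y <= 2 * T * r `^ al.
Proof.
move=> m0 k0 b0 C0 c00 T0 al absorb f G F u x0 hG hf cu super u0 ux0 Fx0 x01.
move=> r y /andP[r0 r4] yx0.
(* The barrier lives in the ball of radius r around y, hence in the ball of
   radius 2 * r around x0, which is contained in the unit ball as r <= 1/4. *)
have in_ball1 z : enorm (z - x0) < 2 * r -> eball 0 1 z.
  move=> zx0; rewrite /eball /= subr0 -[z](subrK x0).
  by rewrite (le_lt_trans (ler_enormD _ _))//; lra.
have near_x0 z : enorm (z - y) <= r -> enorm (z - x0) < 2 * r.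
  by move=> zy; have := ler_enorm_distD y z x0; lra.
have p0 s : 0 < r `^ s by rewrite powR_gt0.
have r1 : r `^ (al - 1) * r = r `^ al.
  rewrite -{2}(powRr1 (ltW r0)) -powRD ?subrK//.
  by rewrite (gt_eqF r0) implybT.
have r2 : r `^ (al - 2) * r = r `^ (al - 1).
  rewrite -{2}(powRr1 (ltW r0)) -powRD; last by rewrite (gt_eqF r0) implybT.
  by congr (_ `^ _); ring.
have topE : T * r `^ (al - 1) * r + T * r `^ (al - 2) * r ^+ 2 = 2 * T * r `^ al.
  by rewrite expr2 -!mulrA (mulrA _ r r) r2 r1; ring.
have slopeE : T * r `^ (al - 1) + 2 * (T * r `^ (al - 2)) * r =
    3 * T * r `^ (al - 1).
  by rewrite -!mulrA r2; ring.
rewrite -topE.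
apply: (@supersolution_le_of_zero R n (eball 0 1) G u y x0 r) => //.
- exact: open_eball.
- by move=> x xr; exact/in_ball1/near_x0.
- by rewrite enorm_distC.
- by rewrite mulr_gt0.
- by rewrite mulr_gt0.
move=> z xi zy; rewrite topE slopeE => uz xiT.
have Bz : eball 0 1 z by apply/in_ball1/near_x0/ltW.
apply: le_lt_trans (absorb r r0).
(* The structure condition is used with r = s = 1 only: the scaling in r is
   carried by the barrier. *)
have := hG 1 1 z (u z) xi; rewrite ltr01 lexx mul1r scale1r !powR1 !mulr1.
move=> /(_ isT isT Bz) => hGz.
apply: le_trans (ler_norm _) _; apply: le_trans hGz _.
have le_pow s a b : 0 <= s -> 0 <= a -> a <= b -> a `^ s <= b `^ s.
  by move=> s0 a0 ab; apply: ge0_ler_powR; rewrite ?nnegrE// (le_trans a0).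
apply: ler_pM; rewrite ?mulr_ge0 ?powR_ge0 ?normr_ge0 ?(ltW C0)//.
- by rewrite le_min ler01 powR_ge0.
- apply: ler_pM; rewrite ?mulr_ge0 ?powR_ge0 ?normr_ge0 ?(ltW C0)//.
    rewrite -!mulrA ler_pM2l//; apply: le_trans (hf z Bz) _.
    rewrite ler_wpM2l// le_pow//; first exact: edist_ge0 Fx0.
    by rewrite (le_trans (edist_le _ Fx0))// ltW// near_x0// ltW.
  by rewrite (ger0_norm (u0 z Bz)) le_pow// u0.
by rewrite ge_min le_pow ?enorm_ge0// orbT.
Qed.

End Growth.

(** * Reduction to nonnegative solutions *)

(** If [u] is negative somewhere, both smallness conditions fail once [eps] is
    small compared with that negative value and with the measure of the
    nonempty open set where [u] is negative. *)
Lemma exists_eps_of_neg (R : realType) (n : nat) (u : 'rV[R]_n -> R) p :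
  (0 < n)%N -> {in eball 0 1, continuous u} -> eball 0 1 p -> u p < 0 ->
  exists2 eps : R, 0 < eps &
    ~ ((- eps%:E <= ereal_inf [set (u x)%:E | x in eball (0 : 'rV[R]_n) 1])%E \/
       (lebesgue_n ([set x | (u x < 0)%R] `&` eball 0 1)
          / lebesgue_n (eball (0 : 'rV[R]_n) 1) <= eps%:E)%E).
Proof.
move=> n0 cu Bp up.
set q := (_ / _)%E.
have oB : open (eball (0 : 'rV[R]_n) 1) by exact: open_eball.
have q0 : (0 < q)%E.
  apply: mule_gt0.
    apply: lebesgue_n_open_gt0; last by exists p.
    rewrite setIC; apply: (proj1 (continuous_inP _ oB) cu [set t | t < 0]).
    exact: open_lt.
  rewrite inve_gt0; last 2 first.
  - by rewrite gt_eqF// lebesgue_n_open_gt0//; exists p.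
  - by rewrite lt_eqF// lebesgue_n_eball_lty.
  by rewrite lebesgue_n_open_gt0//; exists p.
have [e2 e20 e2q] : exists2 e2 : R, 0 < e2 & (e2%:E < q)%E.
  case: q q0 => [s| |]//; rewrite ?lte_fin => s0; last by exists 1; rewrite ?ltry.
  by exists (s / 2); rewrite ?lte_fin; lra.
exists (Num.min (- u p / 2) e2); first by rewrite lt_min e20 andbT; lra.
set e1 := Num.min _ _; case.
- apply/negP; rewrite -ltNge.
  apply: le_lt_trans (_ : (u p)%:E < _)%E.
    by apply: ereal_inf_lbound; exists p.
  rewrite -EFinN lte_fin ltrNr /e1 gt_min; apply/orP; left; lra.
- apply/negP; rewrite -ltNge; apply: le_lt_trans e2q.
  by rewrite lee_fin /e1 ge_min lexx orbT.
Qed.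

Theorem corollary1p2 (R : realType) (n : nat) (hn : (0 < n)%N)
  (m kappa beta Cstar c0 : R)
  (hm : 0 <= m < 3) (hkappa : 0 <= kappa < 4) (hmk : m < 3 - kappa)
  (hbeta : 0 < beta) (hCstar : 0 < Cstar) (hc0 : 0 < c0)
  (f : 'rV[R]_n -> R)
  (f_cont : {within eball (0 : 'rV[R]_n) 1, continuous f})
  (f_bnd : (Linfty_norm (eball 0 1) f < +oo)%E) :
  exists C : R, 0 < C /\
  forall (G : 'rV[R]_n -> R -> 'rV[R]_n -> R) (F : set 'rV[R]_n)
         (u : 'rV[R]_n -> R) (x0 : 'rV[R]_n),
    structure_condition G f Cstar m kappa ->
    closed F -> F `<=` eball 0 1 ->
    (forall x, eball 0 1 x -> `|f x| <= c0 * edist x F `^ beta) ->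
    {within eball (0 : 'rV[R]_n) 1, continuous u} ->
    viscosity_solution (eball 0 1) G u ->
    (Linfty_norm (eball 0 1) u <= 1)%E ->
    (critical_zeros u `&` F `&` eball 0 (1 / 2)) x0 ->
    exists eps : R, 0 < eps /\
      ((- eps%:E <= ereal_inf [set (u x)%:E | x in eball (0 : 'rV[R]_n) 1])%E \/
       (lebesgue_n ([set x | (u x < 0)%R] `&` eball 0 1)
          / lebesgue_n (eball (0 : 'rV[R]_n) 1) <= eps%:E)%E ->
       forall r : R, 0 < r < 1 / 2 ->
         (ereal_sup [set `|u x|%:E | x in eball x0 r]
            <= (C * r `^ ((4 - kappa + beta) / (3 - (m + kappa))))%:E)%E).
Proof.
have [[m0 _] [k0 _]] := (andP hm, andP hkappa).
have mk : m + kappa < 3 by lra.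
have [T T0 absorb] := barrier_absorbs beta (mulr_gt0 hCstar hc0) mk.
set al := (4 - kappa + beta) / (3 - (m + kappa)) in absorb *.
have al0 : 0 <= al by rewrite divr_ge0; lra.
(* The first term serves the radii up to 1/4, where the barrier fits in the
   unit ball; the second one makes the bound at least 1 for larger radii. *)
exists (2 * T + 4 `^ al); split; first by rewrite addr_gt0 ?mulr_gt0 ?powR_gt0.
move=> G F u x0 hG _ _ hf cu [_ super] u1 [[[_ ux0 _ _] Fx0] x0B].
have oB : open (eball (0 : 'rV[R]_n) 1) by exact: open_eball.
rewrite continuous_open_subspace// in cu.
have [upos|] := pselect (forall x, eball 0 1 x -> 0 <= u x); last first.
  move=> /existsNP[p /not_implyP[Bp /negP]]; rewrite -ltNge => up.
  by have [eps eps0 neps] := exists_eps_of_neg hn cu Bp up; exists eps.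
(* For nonnegative u the estimate holds whatever the smallness condition. *)
exists 1; split=> // _ r /andP[r0 r2].
have x0n : enorm x0 < 1 / 2 by move: x0B; rewrite /eball /= subr0.
apply: ge_ereal_sup => _ [y yr <-]; rewrite lee_fin mulrDl.
have yB : eball 0 1 y.
  rewrite /eball /= subr0 -[y](subrK x0).
  by rewrite (le_lt_trans (ler_enormD _ _))//; move: yr; rewrite /eball /=; lra.
have [r4|r4] := leP r (1 / 4).
  rewrite ger0_norm ?upos// ler_wpDr ?mulr_ge0 ?powR_ge0//.
  apply: (nonneg_growth m0 k0 (ltW hbeta) hCstar (ltW hc0) T0 absorb hG hf cu
    super upos ux0 Fx0 x0n _ yr).
  by rewrite r0.
rewrite ler_wpDl ?mulr_ge0 ?powR_ge0 ?(ltW T0)//.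
apply: le_trans (le_Linfty_norm_of_continuous oB cu u1 yB) _.
apply: (@le_trans _ _ (1 `^ al)); first by rewrite powR1.
rewrite -powRM ?(ltW r0)// ge0_ler_powR ?nnegrE//.
  by rewrite mulr_ge0 ?(ltW r0).
by move: r4; lra.
Qed.
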